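(* For every integer $n\geq 2$, $$\lfloor e^{w(n)}\rfloor -2\leq K_n\leq \lfloor e^{w(n)}\rfloor +1.$$
   Context: $S(n,k)$ denotes the Stirling number of the second kind (the number of partitions of $\{1,\ldots,n\}$ into $k$ nonempty blocks), with $S(n,k)=0$ for $k=0$ (when $n\geq1$) and for $k>n$. For $n\geq 1$ the sequence $S(n,1),\ldots,S(n,n)$ is strictly log-concave, so there is a unique integer $K_n$ with $1\leq K_n\leq n$ such that $S(n,K_n-1)<S(n,K_n)\geq S(n,K_n+1)$. $w(n)$ denotes Lambert's W function, i.e. the unique real $w>0$ with $n=we^{w}$ (for $n>0$). $\lfloor x\rfloor$ is the integer part of $x$. *)

(* Defs.v *)
From Stdlib Require Import Reals Lra Lia ZArith Arith.
Open Scope R_scope.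

Fixpoint stirling2 (n k : nat) : nat :=
  match n, k with
  | O, O => 1%nat
  | O, S _ => 0%nat
  | S _, O => 0%nat
  | S n', S k' => (S k' * stirling2 n' (S k') + stirling2 n' k')%nat
  end.

(* k is the (unique) mode index K_n of S(n,1..n):
   1 <= k <= n and S(n,k-1) < S(n,k) >= S(n,k+1). *)
Definition is_K (n k : nat) : Prop :=
  (1 <= k <= n)%nat /\
  (stirling2 n (k - 1) < stirling2 n k)%nat /\
  (stirling2 n (k + 1) <= stirling2 n k)%nat.

Definition is_lambertW (x w : R) : Prop := 0 < w /\ x = w * exp w.

Definition floorR (x : R) : Z := (up x - 1)%Z.

(* Main.v *)
(** Write x = e^w, so that x ln x = n, let B_n be the Bell numbers and put
    r = B_(n+1) / B_n.  The Touchard polynomial sum_k S(n,k) X^k has only real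
    nonpositive roots, so S(n,k) / B_n is the distribution of a sum of
    independent Bernoulli variables; its mean is r - 1, and by Darroch's theorem
    its mode differs from the mean by less than 1.  On the other hand r is the
    mean of the distribution proportional to k^n / k! (Dobinski), and Jensen's
    inequality for convex exponentials under such distributions gives
    r >= exp (n / (r + 1)) and r - 1 <= exp ((n - 1) / (r - 1)), whence
    x - 1 < r < x + 1. *)

Require Import Defs.
From Stdlib Require Import Reals ZArith Arith Lra Lia.
From Coquelicot Require Import Coquelicot.
From mathcomp Require all_boot all_order all_algebra realalg polyrcf ring lra.
Open Scope R_scope.

Module StirlingMode.

Import all_boot all_order all_algebra realalg ring lra.
Import Order.TTheory GRing.Theory Num.Theory.
Set Implicit Arguments.
Unset Strict Implicit.
Unset Printing Implicit Defensive.
Local Open Scope ring_scope.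

(** * Poisson binomial distributions: monotonicity on either side of the mean *)

Section PoissonBinomial.

Variables (R : realFieldType) (I : finType) (p : I -> R).
Implicit Types (A : {set I}) (i j : I) (k m n : nat).

Definition bernoulli_poly (i : I) : {poly R} := (1 - p i)%:P + (p i)%:P * 'X.

(** Probability generating function of the number of successes among independent trials indexed by
    [A], trial [i] succeeding with probability [p i]. *)
Definition pb_poly (A : {set I}) : {poly R} := \prod_(i in A) bernoulli_poly i.

Definition pb_mean (A : {set I}) : R := \sum_(i in A) p i.

Lemma pb_polyD1 A i : i \in A ->
  pb_poly A = bernoulli_poly i * pb_poly (A :\ i).
Proof. by move=> iA; rewrite /pb_poly (big_setD1 i). Qed.

Lemma pb_meanD1 A i : i \in A -> pb_mean A = p i + pb_mean (A :\ i).
Proof. by move=> iA; rewrite /pb_mean (big_setD1 i). Qed.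

Lemma coef_pb_poly A i k : i \in A ->
  (pb_poly A)`_k = (1 - p i) * (pb_poly (A :\ i))`_k
                   + p i * ('X * pb_poly (A :\ i))`_k.
Proof.
by move=> iA; rewrite (pb_polyD1 iA) mulrDl -mulrA coefD !coefCM.
Qed.

Lemma deriv_pb_poly A :
  (pb_poly A)^`() = \sum_(i in A) (p i)%:P * pb_poly (A :\ i).
Proof.
have [n] := ubnP #|A|; elim: n A => // n IH A /ltnSE leAn.
have [->|[i iA]] := set_0Vmem A.
  by rewrite /pb_poly !big_set0 -polyC1 derivC.
rewrite (pb_polyD1 iA) derivM (big_setD1 i) //= IH; last first.
  by rewrite (cardsD1 i) iA in leAn.
rewrite derivD derivC add0r derivM derivC derivX mul0r add0r mulr1.
congr (_ + _); rewrite mulr_sumr; apply: eq_bigr => j /setD1P[neq_ji jA].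
rewrite (@pb_polyD1 (A :\ j) i) ?in_setD1 1?eq_sym ?neq_ji //.
by rewrite mulrCA setDDl setUC -setDDl.
Qed.

Lemma pb_poly_horner1 A : (pb_poly A).[1] = 1.
Proof.
rewrite /pb_poly horner_prod big1 // => i _.
by rewrite /bernoulli_poly !hornerE subrK.
Qed.

Lemma deriv_pb_poly_horner1 A : (pb_poly A)^`().[1] = pb_mean A.
Proof.
rewrite deriv_pb_poly horner_sum; apply: eq_bigr => i _.
by rewrite hornerM hornerC pb_poly_horner1 mulr1.
Qed.

(** Compare coefficients in [deriv_pb_poly]; in probabilistic terms, single out one of the [k.+1]
    successes. *)
Lemma coefS_pb_poly A k :
  k.+1%:R * (pb_poly A)`_k.+1 = \sum_(i in A) p i * (pb_poly (A :\ i))`_k.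
Proof.
rewrite mulr_natl -coef_deriv deriv_pb_poly coef_sum.
by apply: eq_bigr => i _; rewrite coefCM.
Qed.

Lemma coef_pb_poly_eq0 A k : (#|A| < k)%N -> (pb_poly A)`_k = 0.
Proof.
have [n] := ubnP #|A|; elim: n A k => // n IH A k /ltnSE leAn ltAk.
have [A0|[i iA]] := set_0Vmem A.
  by move: ltAk; rewrite A0 /pb_poly big_set0 coef1 cards0; case: k.
rewrite (cardsD1 i) iA in leAn ltAk.
rewrite (coef_pb_poly _ iA) coefXM; case: k ltAk => // k ltAk /=.
by rewrite !IH ?mulr0 ?addr0 // ltnW.
Qed.

Hypothesis p_ge0 : forall i, 0 <= p i.
Hypothesis p_le1 : forall i, p i <= 1.

Lemma coef_pb_poly_ge0 A k : 0 <= (pb_poly A)`_k.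
Proof.
have [n] := ubnP #|A|; elim: n A k => // n IH A k /ltnSE leAn.
have [->|[i iA]] := set_0Vmem A.
  by rewrite /pb_poly big_set0 coef1 ler0n.
rewrite (cardsD1 i) iA in leAn.
rewrite (coef_pb_poly _ iA) coefXM addr_ge0 // mulr_ge0 ?subr_ge0 ?IH //.
by case: eqP; rewrite ?IH.
Qed.

(* Weighting f_m = g_m - p_i (g_m - g_(m-1)), where g omits the factor i, by
   p_i and summing over i compares the mean of A with the index m.+1. *)
Lemma coefS_pb_poly_sub A m :
  m.+1%:R * ((pb_poly A)`_m.+1 - (pb_poly A)`_m)
  = (pb_mean A - m.+1%:R) * (pb_poly A)`_m
    + \sum_(i in A) p i ^+ 2 *
        ((pb_poly (A :\ i))`_m - ('X * pb_poly (A :\ i))`_m).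
Proof.
rewrite mulrBr coefS_pb_poly mulrBl addrAC; congr (_ - _).
rewrite /pb_mean mulr_suml -big_split /=; apply: eq_bigr => i iA.
by rewrite (coef_pb_poly _ iA); ring.
Qed.

(** Both terms of [coefS_pb_poly_sub] are nonnegative. For the sum, induct on the size of [A]:
    deleting [i] lowers the mean by [p i <= 1], which the passage from [m] to [m - 1] absorbs. *)
Lemma pb_poly_incr A m :
  m.+1%:R <= pb_mean A -> (pb_poly A)`_m <= (pb_poly A)`_m.+1.
Proof.
have [n] := ubnP #|A|; elim: n A m => // n IH A m /ltnSE leAn le_mu.
rewrite -subr_ge0 -(@pmulr_rge0 _ m.+1%:R) ?ltr0n // coefS_pb_poly_sub.
rewrite addr_ge0 ?mulr_ge0 ?subr_ge0 ?coef_pb_poly_ge0 //.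
apply: sumr_ge0 => i iA; rewrite mulr_ge0 ?sqr_ge0 // subr_ge0 coefXM.
case: m le_mu => [|m] le_mu /=; first exact: coef_pb_poly_ge0.
apply: IH; first by rewrite (cardsD1 i) iA in leAn.
rewrite (pb_meanD1 iA) in le_mu; have := p_le1 i.
by rewrite -natr1 in le_mu; lra.
Qed.

Lemma pb_poly_incr_strict A m : m.+1%:R < pb_mean A ->
  0 < (pb_poly A)`_m -> (pb_poly A)`_m < (pb_poly A)`_m.+1.
Proof.
move=> lt_mu pos; rewrite -subr_gt0 -(@pmulr_rgt0 _ m.+1%:R) ?ltr0n //.
rewrite coefS_pb_poly_sub ltr_pwDl ?mulr_gt0 ?subr_gt0 //.
apply: sumr_ge0 => i iA; rewrite mulr_ge0 ?sqr_ge0 // subr_ge0 coefXM.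
case: m lt_mu {pos} => [|m] lt_mu /=; first exact: coef_pb_poly_ge0.
apply: pb_poly_incr; rewrite (pb_meanD1 iA) in lt_mu; have := p_le1 i.
by rewrite -natr1 in lt_mu; lra.
Qed.

(** Dual of [coefS_pb_poly]: with [k] successes, one of the [#|A| - k] failures is singled out. *)
Lemma sum_coef_pb_polyD1 A k :
  \sum_(i in A) (1 - p i) * (pb_poly (A :\ i))`_k
  = (#|A|%:R - k%:R) * (pb_poly A)`_k.
Proof.
rewrite mulrBl.
have -> : k%:R * (pb_poly A)`_k
    = \sum_(i in A) p i * ('X * pb_poly (A :\ i))`_k.
  case: k => [|k].
    by rewrite mul0r big1 // => i _; rewrite coefXM mulr0.
  by rewrite coefS_pb_poly; apply: eq_bigr => i _; rewrite coefXM.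
rewrite -sum1_card natr_sum mulr_suml -sumrB; apply: eq_bigr => i iA.
by rewrite mul1r (coef_pb_poly _ iA) addrK.
Qed.

(** Write f for the coefficients of [A] and g for those of [A :\ i]. By induction g_(k+1) <= g_k, so
    f_(k+1) <= g_k, being a convex combination of the two. Weighting by [1 - p i] and summing gives
    (#|A| - mean) f_(k+1) <= (#|A| - k) f_k, and mean <= k. *)
Lemma pb_poly_decr A k :
  pb_mean A <= k%:R -> (pb_poly A)`_k.+1 <= (pb_poly A)`_k.
Proof.
have [n] := ubnP #|A|; elim: n A k => // n IH A k /ltnSE leAn le_mu.
have [leAk|ltkA] := leqP #|A| k.
  by rewrite coef_pb_poly_eq0 // coef_pb_poly_ge0.
have Nk : 0 < #|A|%:R - k%:R :> R by rewrite subr_gt0 ltr_nat.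
rewrite -(ler_pM2l Nk) -sum_coef_pb_polyD1.
apply: (@le_trans _ _ ((#|A|%:R - pb_mean A) * (pb_poly A)`_k.+1)).
  by rewrite ler_wpM2r ?coef_pb_poly_ge0 // lerD2l lerN2.
rewrite /pb_mean -sum1_card natr_sum -sumrB mulr_suml.
apply: ler_sum => i iA; rewrite ler_wpM2l ?subr_ge0 //.
have IHi : (pb_poly (A :\ i))`_k.+1 <= (pb_poly (A :\ i))`_k.
  apply: IH; first by rewrite (cardsD1 i) iA in leAn.
  by rewrite (pb_meanD1 iA) in le_mu; have := p_ge0 i; lra.
rewrite (coef_pb_poly _ iA) coefXM /= -lerBrDr.
have -> : (pb_poly (A :\ i))`_k - p i * (pb_poly (A :\ i))`_k
  = (1 - p i) * (pb_poly (A :\ i))`_k by ring.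
by rewrite ler_wpM2l ?subr_ge0.
Qed.

End PoissonBinomial.

(** * Sign changes of T + T' along the roots of T *)

Section TouchardRoots.

Variable R : rcfType.
Implicit Types (q : {poly R}) (x y z : R) (s t c : seq R).

(** The intermediate value theorem yields one root in each gap of a decreasing list along which [q]
    alternates in sign. *)
Lemma interlaced_roots q x s :
  path (fun x y => (y < x) && (q.[x] * q.[y] < 0)) x s ->
  exists c, [/\ size c = size s, path >%R x c & all (root q) c].
Proof.
elim: s x => [|y s IH] x /=; first by exists [::].
case/andP=> /andP[lt_yx sg] /IH[c [sz_c path_c root_c]].
rewrite mulrC in sg.
have [z /itvP z_yx rz] := polyrcf.poly_ivtoo (ltW lt_yx) sg.
exists (z :: c); rewrite /= sz_c rz root_c z_yx; split=> //=.
case: c path_c {sz_c root_c} => //= u c /andP[lt_uy ->].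
by rewrite (lt_trans lt_uy) // z_yx.
Qed.

Lemma prod_XsubC_same_sign s x y :
  (forall z, z \in s -> 0 < (x - z) * (y - z)) ->
  0 < (\prod_(z <- s) ('X - z%:P)).[x] * (\prod_(z <- s) ('X - z%:P)).[y].
Proof.
elim: s => [|z s IH] pos; first by rewrite big_nil !hornerC mulr1 ltr01.
rewrite big_cons !hornerM !hornerXsubC mulrACA mulr_gt0 ?pos ?mem_head //.
by apply: IH => u su; rewrite pos // in_cons su orbT.
Qed.

(** At a root of [T], T + T' equals T', whose sign alternates along consecutive simple roots. The
    prefix [s1] holds the roots already passed, so that [T] stays fixed during the induction. *)
Lemma add_deriv_alternates s1 x s2 :
  let T := \prod_(z <- s1 ++ x :: s2) ('X - z%:P) in
  pairwise >%R (s1 ++ x :: s2) ->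
  path (fun x y => (y < x) && ((T + T^`()).[x] * (T + T^`()).[y] < 0)) x s2.
Proof.
elim: s2 s1 x => [|y s2 IH] s1 x //= sorted_s.
have {}IH := IH (rcons s1 x) y; rewrite cat_rcons in IH.
rewrite IH // andbT.
move: sorted_s; rewrite pairwise_cat allrel_consr allrel_consr /=.
case/and3P=> /and3P[gt_x gt_y _] _ /and3P[/andP[lt_yx lt_x] lt_y _].
rewrite lt_yx /=; set G := \prod_(z <- s1 ++ s2) ('X - z%:P).
have -> : \prod_(z <- s1 ++ [:: x, y & s2]) ('X - z%:P)
    = ('X - x%:P) * (('X - y%:P) * G).
  by rewrite /G !big_cat !big_cons /=; ring.
set Q := _ + _.
have Qx : Q.[x] = (x - y) * G.[x].
  by rewrite /Q derivM derivXsubC hornerD !hornerM !hornerE /=; ring.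
have Qy : Q.[y] = (y - x) * G.[y].
  by rewrite /Q !(derivM, derivXsubC) !hornerE /=; ring.
have GG : 0 < G.[x] * G.[y].
  apply: prod_XsubC_same_sign => z; rewrite mem_cat => /orP[zs|zs].
    have zx : x < z := allP gt_x _ zs; have zy : y < z := allP gt_y _ zs.
    by rewrite nmulr_rgt0 subr_lt0.
  have zx : z < x := allP lt_x _ zs; have zy : z < y := allP lt_y _ zs.
  by rewrite pmulr_rgt0 subr_gt0.
rewrite Qx Qy mulrACA pmulr_llt0 // pmulr_rlt0 ?subr_gt0 //.
by rewrite subr_lt0.
Qed.

(** Even size means odd degree, so [- (q \Po - 'X)] is again monic and is at least 1 far to the
    right. *)
Lemma odd_monic_lt0 q y :
  q \is monic -> ~~ odd (size q) -> exists2 x, x < y & q.[x] < 0.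
Proof.
move=> q_monic q_odd.
have lc : lead_coef (- (q \Po - 'X)) = 1.
  rewrite lead_coefN lead_coef_comp ?size_polyN ?size_polyX //.
  rewrite (monicP q_monic) mul1r lead_coefN lead_coefX.
  case: (size q) q_odd (size_poly_eq0 q) => [|m] /=.
    by rewrite eqxx (negbTE (monic_neq0 q_monic)).
  by rewrite negbK => m_odd _; rewrite -signr_odd m_odd expr1 opprK.
have lc_gt0 : 0 < lead_coef (- (q \Po - 'X)) by rewrite lc ltr01.
have [x ge_x] := polyrcf.poly_pinfty_gt_lc lc_gt0.
(* The maximum with [1 - y] puts the witness to the left of [y]. *)
exists (- Num.max x (1 - y)).
  by rewrite ltrNl lt_max; apply/orP; right; lra.
have := ge_x (Num.max x (1 - y)); rewrite le_max lexx => /(_ isT).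
rewrite lc hornerN horner_comp hornerN hornerX.
by rewrite lerNr => /le_lt_trans-> //; rewrite oppr_lt0 ltr01.
Qed.

(* With T = (X - x) G, T + T' takes the value G(x) at x, which has the sign of G
   to the left of x; and (T + T') G has odd degree. *)
Lemma add_deriv_last_sign s x :
  let T := \prod_(z <- rcons s x) ('X - z%:P) in
  pairwise >%R (rcons s x) -> T + T^`() \is monic ->
  size (T + T^`()) = size T ->
  exists2 y, y < x & (T + T^`()).[x] * (T + T^`()).[y] < 0.
Proof.
move=> T; rewrite -cats1 pairwise_cat allrel1r => /andP[lt_x _] mon sz.
pose G := \prod_(z <- s) ('X - z%:P).
have TE : T = ('X - x%:P) * G by rewrite /T big_rcons /= mulrC.
have G_monic : G \is monic by apply: monic_prod_XsubC.
have [|y lt_yx] := @odd_monic_lt0 ((T + T^`()) * G) x (rpredM mon G_monic).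
  rewrite size_monicM ?monic_neq0 // sz TE size_monicM ?monicXsubC ?monic_neq0 //.
  rewrite size_XsubC; case: (size G) (size_poly_eq0 G) => [|m _].
    by rewrite eqxx (negbTE (monic_neq0 G_monic)).
  by rewrite add2n /= addnS /= addnn odd_double.
have : (T + T^`()).[x] = G.[x].
  by rewrite TE derivM derivXsubC !hornerE /=; ring.
set Q := T + T^`(); rewrite hornerM => -> neg; exists y => //.
have : 0 < G.[x] * G.[y].
  apply: prod_XsubC_same_sign => z zs.
  have zx : x < z := allP lt_x _ zs.
  by rewrite nmulr_rgt0 subr_lt0 // (lt_trans lt_yx).
by nra.
Qed.

(** * Touchard polynomials: real roots and factorization *)

Lemma stirling2_eq0 n k : (n < k)%N -> stirling2 n k = 0%N.
Proof.
elim: n k => [|n IH] [|k] //= lt_nk.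
by rewrite !IH ?Nat.mul_0_r // ltnW.
Qed.

Lemma stirling2_diag n : stirling2 n n = 1%N.
Proof. by elim: n => //= n ->; rewrite stirling2_eq0 // Nat.mul_0_r. Qed.

Lemma stirling2SS n k :
  stirling2 n.+1 k.+1 = (k.+1 * stirling2 n k.+1 + stirling2 n k)%N.
Proof. by []. Qed.

Definition touchard n : {poly R} := \poly_(k < n.+1) (stirling2 n k)%:R.

Lemma coef_touchard n k : (touchard n)`_k = (stirling2 n k)%:R.
Proof. by rewrite coef_poly ltnS; case: leqP => // /stirling2_eq0->. Qed.

Lemma touchardS n : touchard n.+1 = 'X * (touchard n + (touchard n)^`()).
Proof.
apply/polyP=> -[|k]; rewrite coefXM coef_touchard //.
rewrite [_.+1 == _]/= coefD coef_deriv !coef_touchard.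
by rewrite stirling2SS natrD natrM mulr_natl addrC.
Qed.

Lemma size_touchard n : size (touchard n) = n.+1.
Proof. by rewrite size_poly_eq // stirling2_diag oner_eq0. Qed.

Lemma touchard_monic n : touchard n \is monic.
Proof.
by rewrite monicE lead_coefE size_touchard coef_touchard stirling2_diag.
Qed.

Lemma size_touchard_add_deriv n :
  size (touchard n + (touchard n)^`()) = n.+1.
Proof.
rewrite size_polyDl ?size_touchard //.
by rewrite -[X in (_ < X)%N](size_touchard n) lt_size_deriv // monic_neq0 // touchard_monic.
Qed.

Lemma touchard_add_deriv_monic n :
  touchard n + (touchard n)^`() \is monic.
Proof.
rewrite monicE lead_coefE size_touchard_add_deriv coefD coef_deriv.
by rewrite !coef_touchard stirling2_diag stirling2_eq0 // mul0rn addr0.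
Qed.

(** By [touchardS] the next polynomial is X (T + T'). The factor T + T' has a root in each gap
    between roots of T and one more below the smallest; these exhaust its degree and all lie below
    the root 0 of X. *)
Lemma touchard_real_rooted n :
  exists t, [/\ size t = n, path >%R 0 t
              & touchard n.+1 = \prod_(z <- 0 :: t) ('X - z%:P)].
Proof.
have gt_trans : transitive (>%R : rel R) by move=> x y z /[swap]; apply: lt_trans.
elim: n => [|n [t [sz_t path_t TE]]].
  exists [::]; split=> //; rewrite big_seq1 subr0 touchardS.
  have -> : touchard 0 = 1.
    by apply/polyP=> k; rewrite coef_touchard coef1; case: k.
  by rewrite -polyC1 derivC addr0 mulr1.
have sorted_t : pairwise >%R (0 :: t) by rewrite -sorted_pairwise.
pose Q := touchard n.+1 + (touchard n.+1)^`().
have := @add_deriv_last_sign (belast 0 t) (last 0 t); rewrite /= -lastI -TE.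
case=> [|||y lt_y sg_y] //; first exact: touchard_add_deriv_monic.
  by rewrite size_touchard_add_deriv size_touchard.
(* The extra point [y] closes the last gap, below the smallest root. *)
have alt : path (fun x y => (y < x) && (Q.[x] * Q.[y] < 0)) 0 (rcons t y).
  rewrite rcons_path lt_y sg_y !andbT.
  by have := @add_deriv_alternates [::] 0 t sorted_t; rewrite /= -TE.
have [c [sz_c path_c root_c]] := interlaced_roots alt.
exists c; rewrite sz_c size_rcons sz_t; split=> //.
rewrite touchardS big_cons subr0; congr (_ * _).
rewrite [LHS](@all_roots_prod_XsubC _ _ c) ?(monicP (touchard_add_deriv_monic _)).
- by rewrite scale1r.
- by rewrite size_touchard_add_deriv sz_c size_rcons sz_t.
- exact: root_c.
- rewrite uniq_rootsE (sorted_uniq gt_trans _ (path_sorted path_c)) // => x.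
  exact: ltxx.
Qed.

Definition bell n : nat := \sum_(k < n.+1) stirling2 n k.

Lemma touchard_horner1 n : (touchard n).[1] = (bell n)%:R.
Proof.
rewrite horner_poly natr_sum; apply: eq_bigr => k _.
by rewrite expr1n mulr1.
Qed.

(** For a root z <= 0, X - z = (1 - z) ((1 - p) + p X) with p = 1 / (1 - z) in [0, 1]; the product
    of the 1 - z is the value at 1, a Bell number. *)
Lemma touchard_pb n : exists p : 'I_n.+1 -> R,
  [/\ forall i, 0 <= p i, forall i, p i <= 1
    & touchard n.+1 = ((bell n.+1)%:R)%:P * pb_poly p setT].
Proof.
have [t [sz_t path_t TE]] := touchard_real_rooted n.
pose z (i : 'I_n.+1) := (0 :: t)`_i.
have z_le0 i : z i <= 0.
  have : all (fun y => y <= 0) (0 :: t).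
    rewrite /= lexx /=; apply: sub_all (order_path_min _ path_t) => [y /ltW //|].
    by move=> x y u /[swap]; apply: lt_trans.
  by move/allP; apply; rewrite mem_nth //= sz_t.
have z1_gt0 i : 0 < 1 - z i by rewrite subr_gt0 (le_lt_trans (z_le0 i)).
have TE' : touchard n.+1
    = (\prod_i (1 - z i))%:P * pb_poly (fun i => (1 - z i)^-1) setT.
  rewrite TE (big_nth 0) /= sz_t big_mkord /pb_poly.
  rewrite (eq_bigl xpredT _ (fun i => in_setT i)) rmorph_prod -big_split.
  apply: eq_bigr => i _; rewrite /= /bernoulli_poly mulrDr mulrA -!polyCM.
  rewrite mulrBr mulr1 mulfV ?gt_eqF // mul1r addrC; congr (_ + _).
  by rewrite -polyCN; congr (_%:P); rewrite /z; ring.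
exists (fun i => (1 - z i)^-1); split=> [i|i|].
- by rewrite invr_ge0 ltW.
- by rewrite invf_le1 // lerBrDr gerDl.
- rewrite -touchard_horner1 {2}TE' hornerM pb_poly_horner1 hornerC mulr1.
  exact: TE'.
Qed.

End TouchardRoots.

(** * Monotonicity of Stirling numbers in terms of Bell numbers *)

Lemma bell_gt0 n : (0 < bell n)%coq_nat.
Proof. by apply/ssrnat.ltP; rewrite /bell big_ord_recr /= stirling2_diag addn1. Qed.

(** The last identity is [touchardS] evaluated at 1. The concrete real closed field [realalg] lets
    inequalities between naturals be cast there and back. *)
Lemma stirling2_mean n :
  exists p : 'I_n.+1 -> realalg,
  [/\ forall i, 0 <= p i, forall i, p i <= 1,
      forall k, (stirling2 n.+1 k)%:R = (bell n.+1)%:R * (pb_poly p setT)`_k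
    & (bell n.+2)%:R = (bell n.+1)%:R * (pb_mean p setT + 1)].
Proof.
have [p [p_ge0 p_le1 TE]] := touchard_pb realalg n.
exists p; split=> // [k|]; first by rewrite -coef_touchard TE coefCM.
rewrite -(touchard_horner1 realalg n.+2) touchardS hornerM hornerX mul1r.
rewrite hornerD touchard_horner1 TE derivM derivC mul0r add0r hornerM hornerC.
by rewrite deriv_pb_poly_horner1; ring.
Qed.

(** The ratio of Bell numbers is the mean plus 1, so the hypothesis says that the mean exceeds
    [k.+1]. *)
Lemma stirling2_incr n k : (0 < n)%coq_nat ->
  (k.+2 * bell n < bell n.+1)%coq_nat -> (0 < stirling2 n k)%coq_nat ->
  (stirling2 n k < stirling2 n k.+1)%coq_nat.
Proof.
case: n => [|n] /ssrnat.ltP // _ /ssrnat.ltP lt_bell /ssrnat.ltP pos; apply/ssrnat.ltP.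
have [p [p_ge0 p_le1 SE BE]] := stirling2_mean n.
have b_gt0 : 0 < (bell n.+1)%:R :> realalg by rewrite ltr0n; apply/ssrnat.ltP/bell_gt0.
rewrite -(ltr_nat realalg) natrM BE mulrC ltr_pM2l // in lt_bell.
rewrite -(ltr_nat realalg) !SE ltr_pM2l //.
rewrite -(ltr0n realalg) SE pmulr_rgt0 // in pos.
by apply: pb_poly_incr_strict => //; rewrite -[k.+2%:R]natr1 in lt_bell; lra.
Qed.

Lemma stirling2_decr n k : (0 < n)%coq_nat ->
  (bell n.+1 <= k.+1 * bell n)%coq_nat ->
  (stirling2 n k.+1 <= stirling2 n k)%coq_nat.
Proof.
case: n => [|n] /ssrnat.ltP // _ /ssrnat.leP le_bell; apply/ssrnat.leP.
have [p [p_ge0 p_le1 SE BE]] := stirling2_mean n.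
have b_gt0 : 0 < (bell n.+1)%:R :> realalg by rewrite ltr0n; apply/ssrnat.ltP/bell_gt0.
rewrite -(ler_nat realalg) natrM BE mulrC ler_pM2r // in le_bell.
rewrite -(ler_nat realalg) !SE ler_pM2l //.
by apply: pb_poly_decr => //; rewrite -natr1 in le_bell; lra.
Qed.

(** Powers in the basis of falling factorials: the identity [ffactS] mirrors the two terms of the
    Stirling recurrence. *)
Lemma expn_stirling2 n k : (k ^ n = \sum_(j < n.+1) stirling2 n j * k ^_ j)%N.
Proof.
elim: n => [|n IH]; first by rewrite big_ord1 ffactn0.
rewrite expnS IH big_distrr [RHS]big_ord_recl mul0n add0n.
have ffactS j : (k * k ^_ j = k ^_ j.+1 + j * k ^_ j)%N.
  have [le_jk|lt_kj] := leqP j k.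
    by rewrite ffactnSr [(j * _)%N]mulnC -mulnDr subnK // mulnC.
  by rewrite !ffact_small ?muln0 // ltnW.
under eq_bigr => j _ do rewrite /= mulnCA ffactS mulnDr.
rewrite big_split.
under [RHS]eq_bigr => j _ do rewrite lift0 stirling2SS mulnDl addnC.
rewrite big_split /=; congr (_ + _)%N.
(* The first term on the left has factor 0 and the last on the right has factor
   [stirling2 n n.+1 = 0]; the rest agree after an index shift. *)
rewrite [LHS]big_ord_recl mul0n muln0 add0n [RHS]big_ord_recr /=.
rewrite (@stirling2_eq0 n n.+1) // muln0 mul0n addn0.
by apply: eq_bigr => j _; rewrite /bump leq0n add1n mulnA [(_ * j.+1)%N]mulnC.
Qed.

End StirlingMode.

(** * Dobinski's formula for the Bell numbers *)

Module Dobinski.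

Import all_boot StirlingMode.
Local Open Scope R_scope.

Lemma is_series_ffact (j : nat) :
  is_series (fun k => INR (k ^_ j) / INR (fact k)) (exp 1).
Proof.
elim: j => [|j IH].
  apply: (is_series_ext (fun k => scal (pow_n 1 k) (/ INR (fact k)))).
    move=> k; rewrite pow_n_pow pow1 ffactn0 /=.
    by rewrite /scal /= /mult /=; rewrite /Rdiv.
  exact: is_exp_Reals.
(* The term at 0 vanishes, and the shifted series is the one for [j]. *)
apply: is_series_decr_1.
have -> : plus (exp 1) (opp (INR (0 ^_ j.+1) / INR (fact 0))) = exp 1.
  by rewrite ffact0n /plus /opp /=; field.
apply: is_series_ext IH => k.
rewrite ffactSS fact_simpl !mult_INR.
change (INR (k ^_ j) / INR (fact k)
  = INR k.+1 * INR (k ^_ j) / (INR k.+1 * INR (fact k))).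
by field; split; [apply: INR_fact_neq_0|apply: not_0_INR].
Qed.

Lemma is_series_sum_ffact (c : nat -> nat) (m : nat) :
  is_series (fun k => INR (\sum_(j < m) c j * k ^_ j) / INR (fact k))
    (exp 1 * INR (\sum_(j < m) c j)).
Proof.
elim: m => [|m IH].
  rewrite big_ord0 Rmult_0_r.
  apply: (is_series_ext (fun k => scal 0 (INR (k ^_ 0) / INR (fact k)))).
    by move=> k; rewrite big_ord0 /scal /= /mult /= /Rdiv !Rmult_0_l.
  rewrite -[X in is_series _ X](Rmult_0_l (exp 1)).
  exact: is_series_scal (is_series_ffact 0).
rewrite big_ord_recr /= plus_INR Rmult_plus_distr_l.
have H := is_series_plus _ _ _ _ IH
  (is_series_scal (INR (c m)) _ _ (is_series_ffact m)).
rewrite [exp 1 * INR (c m)]Rmult_comm.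
apply: is_series_ext H => k.
rewrite big_ord_recr /= plus_INR mult_INR.
set a := INR (\sum_(_ < _) _).
change (a / INR (fact k) + INR (c m) * (INR (k ^_ m) / INR (fact k))
  = (a + INR (c m) * INR (k ^_ m)) / INR (fact k)).
by field; apply: INR_fact_neq_0.
Qed.

Lemma dobinski (n : nat) :
  is_series (fun k => INR k ^ n / INR (fact k)) (exp 1 * INR (bell n)).
Proof.
apply: is_series_ext (is_series_sum_ffact (stirling2 n) n.+1) => k.
congr (_ / _); rewrite -expn_stirling2.
elim: n => [|n IH] //=.
by rewrite expnS mult_INR IH.
Qed.

End Dobinski.

Import StirlingMode Dobinski.

(** * Jensen bounds on the ratio of consecutive Bell numbers *)

Lemma is_series_ge0 (a : nat -> R) (l : R) :
  (forall k, 0 <= a k) -> is_series a l -> 0 <= l.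
Proof.
  intros Ha Hl.
  rewrite <- (is_series_unique a l Hl).
  (* Writing the zero terms as products lets [Series_scal_l] evaluate the series. *)
  replace 0 with (Series (fun _ => 0 * 0)) by (rewrite Series_scal_l; ring).
  apply Series_le; [|now exists l].
  intros k; rewrite Rmult_0_l; split; [lra|apply Ha].
Qed.

(** Dobinski's series for exponent [S n], without its zero term at 0 and with one factor [j + 1]
    cancelled against the factorial. *)
Lemma dobinski_shift (n : nat) :
  is_series (fun j => (INR j + 1) ^ n / INR (fact j)) (exp 1 * INR (bell (S n))).
Proof.
  apply is_series_ext with (fun j => INR (S j) ^ S n / INR (fact (S j))).
  - intros j. rewrite fact_simpl, mult_INR, S_INR. simpl.
    field. split; [apply INR_fact_neq_0|]. rewrite <- S_INR. now apply not_0_INR.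
  - apply (is_series_incr_1 (fun j => INR j ^ S n / INR (fact j))).
    replace (plus _ _) with (exp 1 * INR (bell (S n))); [apply dobinski|].
    unfold plus; simpl. field.
Qed.

Lemma exp_mult_INR (n : nat) (x : R) : exp (INR n * x) = exp x ^ n.
Proof.
  induction n as [|n IH]; [simpl; now rewrite Rmult_0_l, exp_0|].
  rewrite S_INR, Rmult_plus_distr_r, exp_plus, IH, Rmult_1_l; simpl; ring.
Qed.

Definition bell_ratio (n : nat) : R := INR (bell (S n)) / INR (bell n).

Lemma bell_ratio_mul (n : nat) : INR (bell (S n)) = bell_ratio n * INR (bell n).
Proof.
  unfold bell_ratio; field.
  apply not_0_INR; pose proof (bell_gt0 n); lia.
Qed.

Lemma bell_ratio_pos (n : nat) : 0 < bell_ratio n.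
Proof.
  apply Rdiv_lt_0_compat; apply lt_0_INR; apply bell_gt0.
Qed.

(* [k -> exp (n / (k + 1))] is convex; this is its tangent at [k = r]. *)
Lemma pow_succ_ge_tangent (n k : nat) (r : R) :
  0 < r ->
  INR k ^ n * exp (INR n / (r + 1)) * (1 - INR n * (INR k - r) / (r + 1) ^ 2)
  <= (INR k + 1) ^ n.
Proof.
  intros Hr.
  pose proof (pos_INR k) as Hk. pose proof (pos_INR n) as Hn.
  assert (H1 : INR k <= (INR k + 1) * exp (- / (INR k + 1))).
  { pose proof (exp_ineq1_le (- / (INR k + 1))) as E.
    apply Rle_trans with ((INR k + 1) * (1 + - / (INR k + 1))).
    - right; field; lra.
    - apply Rmult_le_compat_l; lra. }
  assert (H2 : INR k ^ n * exp (INR n * / (INR k + 1)) <= (INR k + 1) ^ n).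
  { apply Rle_trans with
      (((INR k + 1) * exp (- / (INR k + 1))) ^ n * exp (INR n * / (INR k + 1))).
    - apply Rmult_le_compat_r; [left; apply exp_pos|].
      apply pow_incr; lra.
    - right. rewrite Rpow_mult_distr, <- exp_mult_INR, Rmult_assoc, <- exp_plus.
      replace (INR n * - / (INR k + 1) + INR n * / (INR k + 1)) with 0 by ring.
      rewrite exp_0; ring. }
  eapply Rle_trans; [|exact H2].
  rewrite Rmult_assoc. apply Rmult_le_compat_l; [apply pow_le; lra|].
  replace (INR n * / (INR k + 1))
    with (INR n / (r + 1) + INR n * (/ (INR k + 1) - / (r + 1))) by (field; lra).
  rewrite exp_plus. apply Rmult_le_compat_l; [left; apply exp_pos|].
  eapply Rle_trans; [|apply exp_ineq1_le].
  (* The graph of 1 / (k + 1) lies above its tangent at k = r. *)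
  assert (H3 : - (INR k - r) / (r + 1) ^ 2 <= / (INR k + 1) - / (r + 1)).
  { apply Rminus_le.
    replace (_ - _) with (- ((INR k - r) ^ 2 / ((r + 1) ^ 2 * (INR k + 1))))
      by (field; lra).
    apply Ropp_le_cancel; rewrite Ropp_0, Ropp_involutive.
    apply Rmult_le_pos; [apply pow2_ge_0|].
    left; apply Rinv_0_lt_compat, Rmult_lt_0_compat; [apply pow_lt|]; lra. }
  apply Rmult_le_compat_l with (r := INR n) in H3; [|lra].
  lra.
Qed.

(** Divide [pow_succ_ge_tangent] by k! and sum over k. Under the weights k^n / k! the mean of k is
    r, so the linear part of the tangent cancels. *)
Lemma exp_le_bell_ratio (n : nat) :
  exp (INR n / (bell_ratio n + 1)) <= bell_ratio n.
Proof.
  set (r := bell_ratio n).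
  pose proof (bell_ratio_pos n) as Hr; fold r in Hr.
  set (E := exp (INR n / (r + 1))).
  set (d := INR n / (r + 1) ^ 2).
  assert (H : 0 <= exp 1 * INR (bell (S n))
     - (E * (1 + d * r) * (exp 1 * INR (bell n)) - E * d * (exp 1 * INR (bell (S n))))).
  { apply (is_series_ge0 (fun k => (INR k + 1) ^ n / INR (fact k)
      - (E * (1 + d * r) * (INR k ^ n / INR (fact k))
         - E * d * (INR k ^ S n / INR (fact k))))).
    - intros k.
      pose proof (pow_succ_ge_tangent n k r Hr) as T; fold E in T.
      replace (_ - _) with (((INR k + 1) ^ n
        - INR k ^ n * E * (1 - INR n * (INR k - r) / (r + 1) ^ 2)) / INR (fact k)).
      + apply Rmult_le_pos; [lra|].
        left; apply Rinv_0_lt_compat, INR_fact_lt_0.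
      + unfold d; simpl; field. split; [apply INR_fact_neq_0|lra].
    - apply (is_series_minus (V := R_NormedModule)); [apply dobinski_shift|].
      apply (is_series_minus (V := R_NormedModule));
        apply (is_series_scal (V := R_NormedModule)); apply dobinski. }
  rewrite bell_ratio_mul in H; fold r in H.
  assert (Hb : 0 < exp 1 * INR (bell n)).
  { apply Rmult_lt_0_compat; [apply exp_pos|apply lt_0_INR, bell_gt0]. }
  apply Rmult_le_reg_r with (exp 1 * INR (bell n)); [exact Hb|].
  lra.
Qed.

(* Here the convex function is [j -> exp (- n / j)] in the variable [1 / j]. *)
Lemma pow_pred_ge_tangent (n j : nat) (c : R) :
  (INR j + 1) ^ n * exp (- c) * (INR j * (1 + c) - INR n) <= INR j ^ S n.
Proof.
  pose proof (pos_INR j) as Hj. pose proof (pos_INR n) as Hn.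
  pose proof (exp_pos (- c)) as Hc.
  destruct j as [|j].
  (* At [j = 0] the right side is 0 and the left side is at most 0. *)
  { simpl INR. rewrite pow_i by lia.
    rewrite Rplus_0_l, pow1, Rmult_1_l, Rmult_0_l. nra. }
  set (x := INR (S j)) in *.
  assert (Hx : 0 < x) by (apply lt_0_INR; lia).
  assert (H1 : (x + 1) * exp (- / x) <= x).
  { pose proof (exp_ineq1_le (/ x)) as E.
    apply Rle_trans with (x * exp (/ x) * exp (- / x)).
    - apply Rmult_le_compat_r; [left; apply exp_pos|].
      apply Rle_trans with (x * (1 + / x)); [right; field; lra|].
      apply Rmult_le_compat_l; lra.
    - right. rewrite Rmult_assoc, <- exp_plus.
      rewrite Rplus_opp_r, exp_0; ring. }
  assert (H2 : (x + 1) ^ n * exp (INR n * - / x) <= x ^ n).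
  { rewrite exp_mult_INR, <- Rpow_mult_distr. apply pow_incr; split; [|exact H1].
    apply Rmult_le_pos; [lra|left; apply exp_pos]. }
  assert (H3 : exp (- c) * (1 + c - INR n / x) <= exp (INR n * - / x)).
  { replace (INR n * - / x) with (- c + (c - INR n / x)) by (field; lra).
    rewrite exp_plus. apply Rmult_le_compat_l; [lra|].
    pose proof (exp_ineq1_le (c - INR n / x)); lra. }
  simpl pow.
  apply Rle_trans with (x * ((x + 1) ^ n * exp (INR n * - / x)));
    [|apply Rmult_le_compat_l; lra].
  apply Rle_trans with (x * ((x + 1) ^ n * (exp (- c) * (1 + c - INR n / x)))).
  - right; field; lra.
  - apply Rmult_le_compat_l; [lra|].
    apply Rmult_le_compat_l; [apply pow_le; lra|exact H3].
Qed.

(** Divide [pow_pred_ge_tangent] by j! and sum over j. Under the weights (j + 1)^n / j! the mean of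
    j is r - 1, and j^(n+1) / j! sums to the total weight. *)
Lemma bell_ratio_sub_le_exp (n : nat) :
  1 < bell_ratio (S n) ->
  bell_ratio (S n) - 1 <= exp (INR n / (bell_ratio (S n) - 1)).
Proof.
  intros Hr.
  set (r := bell_ratio (S n)) in *.
  (* This value turns the averaged factor (r - 1) (1 + c) - n into r - 1. *)
  set (c := INR n / (r - 1)).
  assert (H : 0 <= exp 1 * INR (bell (S n))
     - (exp (- c) * (1 + c) * (exp 1 * INR (bell (S (S n))))
        - exp (- c) * (1 + c + INR n) * (exp 1 * INR (bell (S n))))).
  { apply (is_series_ge0 (fun j => INR j ^ S n / INR (fact j)
      - (exp (- c) * (1 + c) * ((INR j + 1) ^ S n / INR (fact j))
         - exp (- c) * (1 + c + INR n) * ((INR j + 1) ^ n / INR (fact j))))).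
    - intros j. pose proof (pow_pred_ge_tangent n j c) as T.
      replace (_ - _) with ((INR j ^ S n
        - (INR j + 1) ^ n * exp (- c) * (INR j * (1 + c) - INR n)) / INR (fact j)).
      + apply Rmult_le_pos; [lra|].
        left; apply Rinv_0_lt_compat, INR_fact_lt_0.
      + simpl; field. apply INR_fact_neq_0.
    - apply (is_series_minus (V := R_NormedModule)); [apply dobinski|].
      apply (is_series_minus (V := R_NormedModule));
        apply (is_series_scal (V := R_NormedModule)); apply dobinski_shift. }
  rewrite (bell_ratio_mul (S n)) in H; fold r in H.
  assert (Hb : 0 < exp 1 * INR (bell (S n))).
  { apply Rmult_lt_0_compat; [apply exp_pos|apply lt_0_INR, bell_gt0]. }
  assert (Hc : c * (r - 1) = INR n) by (unfold c; field; lra).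
  assert (H' : exp (- c) * (r - 1) <= 1).
  { apply Rmult_le_reg_r with (exp 1 * INR (bell (S n))); [exact Hb|].
    rewrite <- Hc in H. lra. }
  apply Rmult_le_reg_l with (exp (- c)); [apply exp_pos|].
  rewrite <- exp_plus, Rplus_opp_l, exp_0. exact H'.
Qed.

(** * Comparison with [exp w] and the bounds on the mode *)

(** If r + 1 <= e^w, then w <= n / (r + 1) because n = w e^w, so e^w <= exp (n / (r + 1)) <= r, a
    contradiction. *)
Lemma lambertW_lt_bell_ratio (n : nat) (w : R) :
  is_lambertW (INR n) w -> exp w < bell_ratio n + 1.
Proof.
  intros [Hw Hn]. apply Rnot_le_lt; intros Hle.
  pose proof (exp_le_bell_ratio n) as H. pose proof (bell_ratio_pos n) as Hr.
  assert (w <= INR n / (bell_ratio n + 1)) as Hq.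
  { apply Rmult_le_reg_r with (bell_ratio n + 1); [lra|].
    replace (INR n / _ * _) with (INR n) by (field; lra).
    rewrite Hn. apply Rmult_le_compat_l; lra. }
  assert (exp w <= exp (INR n / (bell_ratio n + 1))) as He.
  { destruct Hq as [Hq| <-]; [left; now apply exp_increasing|lra]. }
  lra.
Qed.

Lemma bell_ratio_lt_lambertW (n : nat) (w : R) :
  (0 < n)%nat -> is_lambertW (INR n) w -> bell_ratio n - 1 < exp w.
Proof.
  intros Hn0 [Hw Hn]. destruct n as [|n]; [lia|].
  apply Rnot_le_lt; intros Hle.
  pose proof (exp_pos w) as Hp.
  pose proof (bell_ratio_sub_le_exp n) as H.
  set (r := bell_ratio (S n)) in *.
  assert (INR n / (r - 1) < w) as Hq.
  { apply Rmult_lt_reg_r with (r - 1); [lra|].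
    replace (INR n / _ * _) with (INR n) by (field; lra).
    (* Here n + 1 = w e^w <= w (r - 1), and the 1 makes the bound on n strict. *)
    rewrite S_INR in Hn. nra. }
  apply exp_increasing in Hq. lra.
Qed.

Theorem theorem1 :
  forall (n K : nat) (w : R),
    (2 <= n)%nat ->
    is_K n K ->
    is_lambertW (INR n) w ->
    (floorR (exp w) - 2 <= Z.of_nat K <= floorR (exp w) + 1)%Z.
Proof.
  intros n K w Hn [[HK _] [Hlt Hge]] Hw.
  pose proof (lambertW_lt_bell_ratio n w Hw) as Hlo.
  pose proof (bell_ratio_lt_lambertW n w ltac:(lia) Hw) as Hup.
  pose proof (bell_ratio_mul n) as Hmul.
  assert (Hb : 0 < INR (bell n)) by apply lt_0_INR, bell_gt0.
  destruct (archimed (exp w)) as [Hu1 Hu2].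
  unfold floorR. split.
  - apply Z.nlt_ge; intros H.
    (* With [exp w < r + 1] this gives K + 2 < r, so the Stirling numbers still increase strictly at
       [K]. *)
    assert (HR : INR K + 3 <= exp w).
    { assert (Z.of_nat K + 4 <= up (exp w))%Z as H' by lia.
      apply IZR_le in H'. rewrite plus_IZR, <- INR_IZR_INZ in H'. lra. }
    assert (stirling2 n K < stirling2 n (S K))%nat.
    { apply stirling2_incr; [lia| |lia].
      apply INR_lt. rewrite mult_INR, Hmul, !S_INR.
      apply Rmult_lt_compat_r; lra. }
    rewrite Nat.add_1_r in Hge; lia.
  - apply Z.nlt_ge; intros H.
    (* With [r - 1 < exp w] this gives r < K, so there is no strict increase from [K - 1] to [K]. *)
    assert (HR : exp w + 1 < INR K).
    { assert (up (exp w) + 1 <= Z.of_nat K)%Z as H' by lia.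
      apply IZR_le in H'. rewrite plus_IZR, <- INR_IZR_INZ in H'. lra. }
    destruct K as [|k]; [lia|].
    assert (stirling2 n (S k) <= stirling2 n k)%nat.
    { apply stirling2_decr; [lia|].
      apply INR_le. rewrite mult_INR, Hmul. apply Rmult_le_compat_r; lra. }
    replace (S k - 1)%nat with k in Hlt by lia. lia.
Qed.
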